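(* Let $(V,\phi)$ be an $n$-Nambu-Lie algebra over $\mathbb{K}$ and let $\tau$ be a $\phi$-compatible $p$-form on $V$ such that $(i_{x_1\cdots x_{p-1}}\tau)\wedge\tau=0$ for all $x_1,\ldots,x_{p-1}\in V$. Then $(V,\tau\wedge\phi)$ is an $(n+p)$-Nambu-Lie algebra.
   Context: $\mathbb{K}$ is a field of characteristic $0$, $V$ is a vector space over $\mathbb{K}$, and $n,p$ are positive integers. An $n$-Nambu-Lie algebra (also called an $n$-Lie algebra) $(V,\phi)$ is a vector space $V$ with a (totally) skew-symmetric $n$-linear map $\phi:V^n\to V$ satisfying the fundamental identity $$\phi(x_1,\ldots,x_{n-1},\phi(y_1,\ldots,y_n))=\sum_{k=1}^n\phi(y_1,\ldots,y_{k-1},\phi(x_1,\ldots,x_{n-1},y_k),y_{k+1},\ldots,y_n)$$ for all $x_1,\ldots,x_{n-1},y_1,\ldots,y_n\in V$. A $p$-form on $V$ (written $\tau\in\wedge^pV$) is a totally skew-symmetric $p$-linear map $\tau:V^p\to\mathbb{K}$. It is $\phi$-compatible if $\tau(\phi(x_1,\ldots,x_n),y_1,\ldots,y_{p-1})=0$ for all $x_1,\ldots,x_n,y_1,\ldots,y_{p-1}\in V$. The map $\tau\wedge\phi:V^{n+p}\to V$ is defined by $$(\tau\wedge\phi)(x_1,\ldots,x_{n+p})=\frac{1}{n!\,p!}\sum_{\sigma\in S_{n+p}}\operatorname{sgn}(\sigma)\,\tau(x_{\sigma(1)},\ldots,x_{\sigma(p)})\,\phi(x_{\sigma(p+1)},\ldots,x_{\sigma(n+p)}).$$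 For $x_1,\ldots,x_{p-1}\in V$, $i_{x_1\cdots x_{p-1}}\tau$ denotes the $1$-form $\tau(x_1,\ldots,x_{p-1},\cdot)$, and its wedge product with $\tau$ is the $(p+1)$-form $$\big((i_{x_1\cdots x_{p-1}}\tau)\wedge\tau\big)(y_1,\ldots,y_{p+1})=\frac{1}{p!}\sum_{\sigma\in S_{p+1}}\operatorname{sgn}(\sigma)\,\tau(x_1,\ldots,x_{p-1},y_{\sigma(1)})\,\tau(y_{\sigma(2)},\ldots,y_{\sigma(p+1)}).$$ *)

(* Defs.v *)
From HB Require Import structures.
From mathcomp Require Import all_boot all_order all_algebra all_fingroup.

Set Implicit Arguments.
Unset Strict Implicit.
Unset Printing Implicit Defensive.

Import GRing.Theory.
Local Open Scope ring_scope.

(* An n-tuple of vectors (x_1, ..., x_n) is a finite function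
   x : {ffun 'I_n -> V}, with indices shifted to start at 0. *)

Section Tuples.
Variables (V : nmodType) (n : nat).

(* (v, x_1, ..., x_{n-1}); only meaningful for 0 < n. *)
Definition prepend (v : V) (x : {ffun 'I_n.-1 -> V}) : {ffun 'I_n -> V} :=
  [ffun i : 'I_n => nth 0 (v :: codom x) i].

(* (x_1, ..., x_{n-1}, v); only meaningful for 0 < n. *)
Definition append (x : {ffun 'I_n.-1 -> V}) (v : V) : {ffun 'I_n -> V} :=
  [ffun i : 'I_n => nth 0 (rcons (codom x) v) i].

Definition replace (x : {ffun 'I_n -> V}) (k : 'I_n) (v : V) :
    {ffun 'I_n -> V} :=
  [ffun i => if i == k then v else x i].

End Tuples.

Section Multilinear.
Variables (K : fieldType) (V W : lmodType K) (n : nat).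
Implicit Type f : {ffun 'I_n -> V} -> W.

Definition multilinear f :=
  forall (x : {ffun 'I_n -> V}) (k : 'I_n),
    linear (fun v : V => f (replace x k v)).

Definition skew_symmetric f :=
  forall (s : 'S_n) (x : {ffun 'I_n -> V}),
    f [ffun i => x (s i)] = (-1) ^+ s *: f x.

End Multilinear.

Section NambuLie.
Variables (K : fieldType) (V : lmodType K).

Definition fundamental_identity n (phi : {ffun 'I_n -> V} -> V) :=
  forall (x : {ffun 'I_n.-1 -> V}) (y : {ffun 'I_n -> V}),
    phi (append x (phi y)) =
    \sum_(k < n) phi (replace y k (phi (append x (y k)))).

Definition nambu_lie n (phi : {ffun 'I_n -> V} -> V) :=
  [/\ multilinear phi, skew_symmetric phi & fundamental_identity phi].

(* Scalar-valued maps take values in K^o, i.e. K as a module over itself,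
   where the scaling *: is the multiplication of K. *)
Definition is_form p (tau : {ffun 'I_p -> V} -> K^o) :=
  multilinear tau /\ skew_symmetric tau.

Definition compatible n p (phi : {ffun 'I_n -> V} -> V)
    (tau : {ffun 'I_p -> V} -> K^o) :=
  forall (x : {ffun 'I_n -> V}) (y : {ffun 'I_p.-1 -> V}),
    tau (prepend (phi x) y) = 0.

(* The factor tau takes the first p of the permuted arguments, f the last n.
   W = V gives tau /\ phi; W = K^o gives the wedge product of forms. *)
Definition wedge (W : lmodType K) p n (tau : {ffun 'I_p -> V} -> K^o)
    (f : {ffun 'I_n -> V} -> W) (x : {ffun 'I_(p + n) -> V}) : W :=
  ((n`! * p`!)%:R : K)^-1 *:
    \sum_(s : 'S_(p + n))
      (-1) ^+ s *: ((tau [ffun i => x (s (lshift n i))] : K) *: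
                    f [ffun j => x (s (rshift p j))]).

(* The 1-form tau(x_1, ..., x_{p-1}, .). *)
Definition contraction p (x : {ffun 'I_p.-1 -> V})
    (tau : {ffun 'I_p -> V} -> K^o) : {ffun 'I_1 -> V} -> K^o :=
  fun y => tau (append x (y ord0)).

End NambuLie.

(* Main.v *)
Require Import Defs.
From HB Require Import structures.
From mathcomp Require Import all_boot all_order all_algebra all_fingroup.

Import GRing.Theory.
Local Open Scope ring_scope.

(** Call a map D : V -> V a derivation of an n-ary bracket f when
    D (f y) = \sum_k f (y with y_k replaced by D (y_k)).  For a multilinear f
    the derivations form a linear space, and for a skew-symmetric f the
    fundamental identity says that every slot operator
    v |-> f (x with x_k replaced by v) is a derivation of f
    ([fundamental_identity_slot], [nambu_lie_slot]).

    Write psi for tau /\ phi.  As a function of v, the vector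
    psi (x with x_k replaced by v) is a linear combination, indexed by the
    permutations s defining the wedge product, of operators of two types,
    according to whether the slot k becomes an argument of phi or of tau.

    - v |-> phi (z with z_k replaced by v) is a derivation of phi, since phi is
      Nambu-Lie, and its values are annihilated by tau, by compatibility.
      A derivation of phi annihilated by tau is a derivation of psi, because
      the terms differentiating an argument of tau vanish
      ([wedge_derivation]).

    - v |-> tau (z with z_j replaced by v) u, with u a value of phi.  It
      vanishes on the values of psi, so being a derivation of psi means that
      \sum_k psi (y with y_k replaced by tau (z; y_k) u) = 0.  Only the
      arguments of phi contribute, and what remains is the antisymmetrisation
      over S_(p+n) of tau (y_1, ..., y_p) tau (z; y_(p+i)) times a factor
      that does not involve these p+1 vectors.  Antisymmetrising over the
      p+1 slots alone already gives 0: this is the hypothesis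
      (i_z tau) /\ tau = 0, a Pluecker relation ([alternating_plucker],
      [rank_one_derivation]).

    Hence all slot operators of psi are derivations of psi, which is the
    fundamental identity. *)

Set Implicit Arguments.
Unset Strict Implicit.

(** * Extending permutations along an injection *)

Section ExtendPerm.
Variables (S T : finType) (f : S -> T).
Hypothesis f_inj : injective f.

Definition extend_fun (q : S -> S) (x : T) : T :=
  if [pick i | f i == x] is Some i then f (q i) else x.

Lemma extend_fun_image q i : extend_fun q (f i) = f (q i).
Proof.
rewrite /extend_fun; case: pickP => [j /eqP/f_inj -> //|/(_ i)].
by rewrite eqxx.
Qed.

Lemma extend_fun_out q x : (forall i, f i != x) -> extend_fun q x = x.
Proof.
move=> xf; rewrite /extend_fun; case: pickP => // i fix_.
by have := xf i; rewrite fix_.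
Qed.

Lemma image_case x : (exists i, x = f i) \/ (forall i, f i != x).
Proof.
case: (pickP (fun i => f i == x)) => [i /eqP <-|xf]; first by left; exists i.
by right=> i; rewrite xf.
Qed.

Lemma extend_fun_inj (q : {perm S}) : injective (extend_fun q).
Proof.
apply: (can_inj (g := extend_fun (q^-1)%g)) => x.
have [[i ->]|xf] := image_case x; last by rewrite !extend_fun_out.
by rewrite !extend_fun_image permK.
Qed.

Definition extend_perm (q : {perm S}) : {perm T} := perm (@extend_fun_inj q).

Lemma extend_perm_image q i : extend_perm q (f i) = f (q i).
Proof. by rewrite permE extend_fun_image. Qed.

Lemma extend_perm_out q x : (forall i, f i != x) -> extend_perm q x = x.
Proof. by move=> xf; rewrite permE extend_fun_out. Qed.

Lemma extend_permM : {morph extend_perm : q r / (q * r)%g}.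
Proof.
move=> q r; apply/permP=> x; rewrite permM.
have [[i ->]|xf] := image_case x; last by rewrite !extend_perm_out.
by rewrite !extend_perm_image permM.
Qed.

Lemma extend_perm1 : extend_perm 1%g = 1%g.
Proof.
apply/permP=> x; rewrite perm1.
have [[i ->]|xf] := image_case x; last by rewrite !extend_perm_out.
by rewrite !extend_perm_image perm1.
Qed.

Lemma extend_perm_tperm a b : extend_perm (tperm a b) = tperm (f a) (f b).
Proof.
apply/permP=> x; have [[i ->]|xf] := image_case x.
  by rewrite extend_perm_image (inj_tperm _ _ _ f_inj).
by rewrite extend_perm_out // tpermD.
Qed.

(** Extension is multiplicative and maps transpositions to transpositions. *)
Lemma odd_extend_perm q : extend_perm q = q :> bool.
Proof.
have [ts -> _] := prod_tpermP q.
elim: ts => [|[a b] ts IHts]; first by rewrite !big_nil extend_perm1 !odd_perm1.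
rewrite !big_cons extend_permM !odd_permM IHts extend_perm_tperm !odd_tperm /=.
by rewrite (inj_eq f_inj).
Qed.

End ExtendPerm.

(** * Tuples with one entry left free *)

Section Replace.
Variables (V : nmodType) (n : nat).
Implicit Types (x z : {ffun 'I_n -> V}) (k : 'I_n) (v : V).

(** The position [k] is the same for all [v], so that [append x] is a slot
    operator; the entry 0 of [append x 0] is a placeholder. *)
Lemma append_replace (n_gt0 : (0 < n)%N) (x : {ffun 'I_n.-1 -> V}) :
  exists k, forall v, append x v = replace (append x 0) k v.
Proof.
case: n n_gt0 x => // m _ x; exists ord_max => v; apply/ffunP=> i.
rewrite !ffunE !nth_rcons size_codom card_ord.
have [->|ne] := eqVneq i ord_max; first by rewrite ltnn eqxx.
by have := ltn_ord i; rewrite ltnS leq_eqVlt [_ == _](negPf ne) /= => ->.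
Qed.

(** The permutation is independent of [v]: for a skew-symmetric map, filling
    the slot [k] and filling the last slot differ by a constant sign. *)
Lemma replace_append z k :
  exists (s : 'S_n) (x : {ffun 'I_n.-1 -> V}),
    forall v, replace z k v = [ffun i => append x v (s i)].
Proof.
case: n z k => [z [] //|m z k].
exists (tperm k ord_max),
  [ffun i => z (tperm k ord_max (widen_ord (leqnSn m) i))].
move=> v; apply/ffunP=> i; rewrite !ffunE nth_rcons size_codom card_ord.
have [->|ne] := eqVneq i k; first by rewrite tpermL ltnn eqxx.
have ne' : tperm k ord_max i != ord_max.
  by apply: contraNneq ne => e; rewrite -(tpermK k ord_max i) e tpermR.
have lt : (tperm k ord_max i < m)%N.
  have := ltn_ord (tperm k ord_max i).
  by rewrite ltnS leq_eqVlt [_ == _](negPf ne').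
rewrite lt -[X in nth _ _ X]/(nat_of_ord (Ordinal lt)).
rewrite codomE (nth_map (Ordinal lt)) ?size_enum_ord // nth_ord_enum ffunE.
congr (z _); rewrite -[LHS](tpermK k ord_max); congr (tperm _ _ _).
exact: val_inj.
Qed.

Lemma replace_prepend z k :
  exists (s : 'S_n) (x : {ffun 'I_n.-1 -> V}),
    forall v, replace z k v = [ffun i => prepend v x (s i)].
Proof.
case: n z k => [z [] //|m z k].
exists (tperm k ord0), [ffun i => z (tperm k ord0 (lift ord0 i))].
move=> v; apply/ffunP=> i; rewrite !ffunE.
have [->|ne] := eqVneq i k; first by rewrite tpermL.
have ne' : ord0 != tperm k ord0 i.
  by apply: contraNneq ne => e; rewrite -(tpermK k ord0 i) -e tpermR.
have [j e] : exists j : 'I_m, tperm k ord0 i = lift ord0 j.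
  by have [j e _] := unlift_some ne'; exists j.
rewrite e /= add0n codomE (nth_map j) ?size_enum_ord // nth_ord_enum ffunE.
by rewrite -e tpermK.
Qed.

End Replace.

(** * Multilinear maps *)

Section Multilinear.
Variables (K : fieldType) (V W : lmodType K) (n : nat).
Variable f : {ffun 'I_n -> V} -> W.
Hypothesis f_lin : multilinear f.

Lemma multilinearP x k a u v :
  f (replace x k (a *: u + v)) = a *: f (replace x k u) + f (replace x k v).
Proof. exact: f_lin. Qed.

Lemma multilinearD x k u v :
  f (replace x k (u + v)) = f (replace x k u) + f (replace x k v).
Proof. by rewrite -[u]scale1r multilinearP !scale1r. Qed.

Lemma multilinear0 x k : f (replace x k 0) = 0.
Proof.
by apply: (addrI (f (replace x k 0))); rewrite -multilinearD !addr0.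
Qed.

Lemma multilinearZ x k a u : f (replace x k (a *: u)) = a *: f (replace x k u).
Proof. by rewrite -[a *: u]addr0 multilinearP multilinear0 addr0. Qed.

Lemma multilinear_sum x k I (r : seq I) (P : pred I) (F : I -> V) :
  f (replace x k (\sum_(i <- r | P i) F i)) =
  \sum_(i <- r | P i) f (replace x k (F i)).
Proof.
exact: (big_morph (fun v => f (replace x k v)) (multilinearD x k)
                  (multilinear0 x k)).
Qed.

End Multilinear.

(** * Derivations of a bracket *)

Section Derivation.
Variables (K : fieldType) (V : lmodType K) (n : nat).
Variable f : {ffun 'I_n -> V} -> V.

Definition derivation (D : V -> V) :=
  forall y, D (f y) = \sum_(k < n) f (replace y k (D (y k))).

Lemma derivation_ext D D' : D =1 D' -> derivation D -> derivation D'.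
Proof. by move=> e dD y; rewrite -e dD; apply: eq_bigr => k _; rewrite e. Qed.

Lemma derivation_scale D a :
  multilinear f -> derivation D -> derivation (fun v => a *: D v).
Proof.
move=> f_lin dD y; rewrite dD scaler_sumr.
by apply: eq_bigr => k _; rewrite multilinearZ.
Qed.

Lemma derivation_sum I (r : seq I) (D : I -> V -> V) :
  multilinear f -> (forall i, derivation (D i)) ->
  derivation (fun v => \sum_(i <- r) D i v).
Proof.
move=> f_lin dD y; rewrite (eq_bigr _ (fun i _ => dD i y)) exchange_big /=.
by apply: eq_bigr => k _; rewrite multilinear_sum.
Qed.

Lemma fundamental_identity_slot : (0 < n)%N ->
  (forall z k, derivation (fun v => f (replace z k v))) ->
  fundamental_identity f.
Proof.
move=> n_gt0 der x y; have [k ek] := append_replace n_gt0 x.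
by rewrite ek der; apply: eq_bigr => i _; rewrite (ek (y i)).
Qed.

Lemma nambu_lie_slot : nambu_lie f ->
  forall z k, derivation (fun v => f (replace z k v)).
Proof.
case=> f_lin f_skew fi z k; have [s [x e]] := replace_append z k.
apply: (@derivation_ext (fun v => (-1) ^+ s *: f (append x v))).
  by move=> v; rewrite e f_skew.
by apply: derivation_scale => // y; apply: fi.
Qed.

End Derivation.

(** * The wedge product of a form and a bracket *)

Section Wedge.
Variables (K : fieldType) (V : lmodType K) (n p : nat).
Variables (phi : {ffun 'I_n -> V} -> V) (tau : {ffun 'I_p -> V} -> K^o).

Implicit Types (s t : 'S_(p + n)) (x y : {ffun 'I_(p + n) -> V}).

Definition lpart s x : {ffun 'I_p -> V} := [ffun i => x (s (lshift n i))].
Definition rpart s x : {ffun 'I_n -> V} := [ffun i => x (s (rshift p i))].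

Definition wedge_term s x : V :=
  (-1) ^+ s *: ((tau (lpart s x) : K) *: phi (rpart s x)).

Lemma wedgeE x :
  wedge tau phi x = ((n`! * p`!)%:R : K)^-1 *: \sum_s wedge_term s x.
Proof. by []. Qed.

Lemma lpart_replacel s x i v :
  lpart s (replace x (s (lshift n i)) v) = replace (lpart s x) i v.
Proof. by apply/ffunP=> j; rewrite !ffunE (inj_eq perm_inj) eq_lshift. Qed.

Lemma rpart_replacel s x i v :
  rpart s (replace x (s (lshift n i)) v) = rpart s x.
Proof. by apply/ffunP=> j; rewrite !ffunE (inj_eq perm_inj) eq_rlshift. Qed.

Lemma lpart_replacer s x i v :
  lpart s (replace x (s (rshift p i)) v) = lpart s x.
Proof. by apply/ffunP=> j; rewrite !ffunE (inj_eq perm_inj) eq_lrshift. Qed.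

Lemma rpart_replacer s x i v :
  rpart s (replace x (s (rshift p i)) v) = replace (rpart s x) i v.
Proof. by apply/ffunP=> j; rewrite !ffunE (inj_eq perm_inj) eq_rshift. Qed.

Lemma wedge_term_replacel s x i v :
  wedge_term s (replace x (s (lshift n i)) v) =
  (-1) ^+ s *: ((tau (replace (lpart s x) i v) : K) *: phi (rpart s x)).
Proof. by rewrite /wedge_term lpart_replacel rpart_replacel. Qed.

Lemma wedge_term_replacer s x i v :
  wedge_term s (replace x (s (rshift p i)) v) =
  (-1) ^+ s *: ((tau (lpart s x) : K) *: phi (replace (rpart s x) i v)).
Proof. by rewrite /wedge_term lpart_replacer rpart_replacer. Qed.

Lemma slot_case s k :
  (exists i, k = s (lshift n i)) \/ (exists i, k = s (rshift p i)).
Proof.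
by rewrite -(permKV s k); case: (split_ordP ((s^-1)%g k)) => i ->;
  [left | right]; exists i.
Qed.

Hypothesis phi_lin : multilinear phi.
Hypothesis tau_lin : multilinear tau.

Lemma multilinear_wedge : multilinear (wedge tau phi).
Proof.
move=> x k a u v; rewrite !wedgeE scalerA mulrC -scalerA -scalerDr.
congr (_ *: _); rewrite scaler_sumr -big_split /=; apply: eq_bigr => s _.
have [[i ->]|[i ->]] := slot_case s k.
  rewrite !wedge_term_replacel (multilinearP tau_lin).
  rewrite scalerDl scalerDr !scalerA; congr (_ *: _ + _).
  by rewrite mulrA [a * _]mulrC.
rewrite !wedge_term_replacer (multilinearP phi_lin).
by rewrite !scalerDr !scalerA; congr (_ *: _ + _); rewrite mulrC mulrA.
Qed.

Lemma skew_symmetric_wedge : skew_symmetric (wedge tau phi).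
Proof.
move=> s x; rewrite !wedgeE [RHS]scalerA [X in _ = X *: _]mulrC -[RHS]scalerA.
congr (_ *: _); rewrite scaler_sumr [RHS](reindex_inj (mulIg s)).
apply: eq_bigr => t _; rewrite /wedge_term odd_permM signr_addb [RHS]scalerA.
rewrite mulrCA -expr2 sqrr_sign mulr1.
by congr (_ *: ((tau _ : K) *: phi _)); apply/ffunP=> i; rewrite !ffunE permM.
Qed.

Hypothesis tau_skew : skew_symmetric tau.
Hypothesis tau_compat : compatible phi tau.

Lemma tau_phi z i (y : {ffun 'I_n -> V}) : tau (replace z i (phi y)) = 0.
Proof.
have [s [x e]] := replace_prepend z i.
by rewrite e tau_skew tau_compat scaler0.
Qed.

Lemma tau_wedge_value z i y : tau (replace z i (wedge tau phi y)) = 0.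
Proof.
rewrite wedgeE (multilinearZ tau_lin) (multilinear_sum tau_lin) big1 ?scaler0 //.
by move=> s _; rewrite !(multilinearZ tau_lin) tau_phi !scaler0.
Qed.

(** The terms in which [D] hits an argument of [tau] vanish, and in each
    remaining one [D] hits an argument of [phi]. *)
Lemma wedge_derive (D : V -> V) y :
  (forall z i v, tau (replace z i (D v)) = 0) ->
  \sum_(k < p + n) wedge tau phi (replace y k (D (y k))) =
  ((n`! * p`!)%:R : K)^-1 *: \sum_(s : 'S_(p + n)) (-1) ^+ s *: ((tau (lpart s y) : K) *:
     \sum_(i < n) phi (replace (rpart s y) i (D (rpart s y i)))).
Proof.
move=> tauD; rewrite -scaler_sumr exchange_big /=; congr (_ *: _).
apply: eq_bigr => s _; rewrite (reindex_inj (@perm_inj _ s)) big_split_ord /=.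
rewrite big1 => [|i _]; last first.
  by rewrite -/(wedge_term _ _) wedge_term_replacel tauD scale0r scaler0.
rewrite add0r !scaler_sumr; apply: eq_bigr => i _.
by rewrite -/(wedge_term _ _) wedge_term_replacer ffunE.
Qed.

Lemma wedge_derivation (D : {linear V -> V}) :
  (forall z i v, tau (replace z i (D v)) = 0) ->
  derivation phi D -> derivation (wedge tau phi) D.
Proof.
move=> tauD dD y; rewrite wedge_derive // wedgeE linearZ linear_sum /=.
congr (_ *: _); apply: eq_bigr => s _.
by rewrite /wedge_term [LHS]linearZ [X in _ *: X = _]linearZ /= dD.
Qed.

Hypothesis char0 : [pchar K] =i pred0.
Hypothesis tau_wedge :
  forall (x : {ffun 'I_p.-1 -> V}) (y : {ffun 'I_(1 + p) -> V}),
    wedge (contraction x tau) tau y = 0.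

Lemma natr_fact_neq0 m : (m`!%:R : K) != 0.
Proof. by rewrite (proj1 (pcharf0P _) char0) // -lt0n fact_gt0. Qed.

(** The hypothesis on [contraction x tau] with the normalising factor removed
    and the free slot of [tau] moved from the last position to [j]. *)
Lemma plucker_slot z j (y : {ffun 'I_(1 + p) -> V}) :
  \sum_(q : 'S_(1 + p)) (-1) ^+ q *
    ((tau (replace z j (y (q (lshift p ord0)))) : K) *
     (tau [ffun i => y (q (rshift 1 i))] : K)) = 0.
Proof.
have [s [x e]] := replace_append z j.
have /eqP := tau_wedge x y; rewrite scaler_eq0 invr_eq0 natrM mulf_eq0.
rewrite !(negPf (natr_fact_neq0 _)) /= => /eqP eq0.
apply: etrans (_ : (-1) ^+ s * 0 = 0); last by rewrite mulr0.
rewrite -[X in _ = _ * X]eq0 mulr_sumr; apply: eq_bigr => q _.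
rewrite e tau_skew /contraction ffunE.
by rewrite /GRing.scale /= !mulrA [_ * (-1) ^+ s]mulrC.
Qed.

(** The p+1 slots entering the Pluecker relation: the i-th argument of the
    bracket, followed by the arguments of the form. *)
Definition exchange_slots (i : 'I_n) (k : 'I_(1 + p)) : 'I_(p + n) :=
  match split k with inl _ => rshift p i | inr j => lshift n j end.

Lemma exchange_slots_l i k : exchange_slots i (lshift p k) = rshift p i.
Proof. by rewrite /exchange_slots (unsplitK (inl k)). Qed.

Lemma exchange_slots_r i k : exchange_slots i (rshift 1 k) = lshift n k.
Proof. by rewrite /exchange_slots (unsplitK (inr k)). Qed.

Lemma exchange_slots_inj i : injective (exchange_slots i).
Proof.
move=> k k'; case: (split_ordP k) => j ->; case: (split_ordP k') => j' ->;
  rewrite ?exchange_slots_l ?exchange_slots_r.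
- by rewrite !ord1.
- by move/eqP; rewrite eq_rlshift.
- by move/eqP; rewrite eq_lrshift.
- by move/lshift_inj ->.
Qed.

(** The group S_(1+p) acts on S_(p+n) by left multiplication through
    [exchange_slots i].  The sum over each coset of this subgroup is a Pluecker
    sum, because the i-th argument of [phi] has been replaced by [u]
    and the others do not move; averaging over the subgroup, whose order is
    invertible in [K], shows that the whole sum vanishes. *)
Lemma alternating_plucker z j i u y :
  \sum_(s : 'S_(p + n)) (-1) ^+ s *: (((tau (lpart s y) : K) *
     (tau (replace z j (rpart s y i)) : K)) *: phi (replace (rpart s y) i u)) = 0.
Proof.
pose F (s : 'S_(p + n)) : V := (-1) ^+ s *: (((tau (lpart s y) : K) *
  (tau (replace z j (rpart s y i)) : K)) *: phi (replace (rpart s y) i u)).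
change (\sum_s F s = 0).
pose hat := extend_perm (@exchange_slots_inj i).
have hatF s : \sum_(q : 'S_(1 + p)) F (hat q * s)%g = 0.
  (* Only the arguments in the 1+p exchanged slots are permuted by hat q. *)
  pose y' : {ffun 'I_(1 + p) -> V} := [ffun k => y (s (exchange_slots i k))].
  apply: etrans (_ : ((-1) ^+ s * 0) *: phi (replace (rpart s y) i u) = 0);
    last by rewrite mulr0 scale0r.
  rewrite -(plucker_slot z j y') mulr_sumr scaler_suml; apply: eq_bigr => q _.
  rewrite /F odd_permM odd_extend_perm signr_addb scalerA.
  have -> : replace (rpart (hat q * s)%g y) i u = replace (rpart s y) i u.
    apply/ffunP=> k; rewrite !ffunE; case: eqP => // /eqP ne; rewrite permM.
    congr (y (s _)); apply: extend_perm_out => m.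
    case: (split_ordP m) => m' ->; rewrite ?exchange_slots_l ?exchange_slots_r.
      by rewrite eq_rshift eq_sym.
    by rewrite eq_lrshift.
  have -> : lpart (hat q * s)%g y = [ffun k => y' (q (rshift 1 k))].
    apply/ffunP=> k; rewrite !ffunE permM -(exchange_slots_r i).
    by rewrite extend_perm_image.
  have -> : rpart (hat q * s)%g y i = y' (q (lshift p ord0)).
    rewrite !ffunE permM -(exchange_slots_l i ord0).
    by rewrite extend_perm_image.
  congr (_ *: _); rewrite -!mulrA mulrCA; congr (_ * (_ * _)); exact: mulrC.
(* Each q contributes the same full sum, by reindexing s as hat q * s. *)
have : (#|{: 'S_(1 + p)}|%:R : K) *: \sum_s F s = 0.
  rewrite scaler_nat -sumr_const.
  rewrite (eq_bigr (fun q => \sum_s F (hat q * s)%g)).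
    by rewrite exchange_big big1.
  by move=> q _; apply: (reindex_inj (mulgI (hat q))).
by move/eqP; rewrite scaler_eq0 card_Sn (negPf (natr_fact_neq0 _)) => /eqP.
Qed.

(** The left-hand side of the derivation identity is 0 because [tau]
    annihilates the values of the wedge product; the right-hand side is a sum
    of alternating Pluecker sums, one for each argument of [phi]. *)
Lemma rank_one_derivation z j (x : {ffun 'I_n -> V}) :
  derivation (wedge tau phi) (fun v => (tau (replace z j v) : K) *: phi x).
Proof.
move=> y; rewrite tau_wedge_value scale0r.
rewrite (@wedge_derive (fun v => (tau (replace z j v) : K) *: phi x)); last first.
  by move=> z' i v; rewrite (multilinearZ tau_lin) tau_phi scaler0.
rewrite (eq_bigr (fun s => \sum_(i < n) (-1) ^+ s *: (((tau (lpart s y) : K) *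
     (tau (replace z j (rpart s y i)) : K)) *:
       phi (replace (rpart s y) i (phi x))))).
  by rewrite exchange_big big1 ?scaler0 // => i _; apply: alternating_plucker.
move=> s _; rewrite !scaler_sumr; apply: eq_bigr => i _.
by rewrite (multilinearZ phi_lin) !scalerA mulrA.
Qed.

Hypothesis phi_der : forall z k, derivation phi (fun v => phi (replace z k v)).

(** In the term of a permutation [s], the slot [k] is either an argument of
    [tau], giving a rank one operator, or an argument of [phi], giving a slot
    operator of [phi]. *)
Lemma wedge_slot_derivation x k :
  derivation (wedge tau phi) (fun v => wedge tau phi (replace x k v)).
Proof.
apply: (derivation_scale _ multilinear_wedge).
apply: (derivation_sum _ multilinear_wedge) => s.
have [[i ->]|[i ->]] := slot_case s k.
  apply: derivation_ext (fun v => esym (wedge_term_replacel s x i v)) _.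
  by apply: (derivation_scale _ multilinear_wedge); apply: rank_one_derivation.
apply: derivation_ext (fun v => esym (wedge_term_replacer s x i v)) _.
do 2!apply: (derivation_scale _ multilinear_wedge).
pose D := GRing.isLinear.Build _ _ _ _ _ (phi_lin (rpart s x) i).
pose L : {linear V -> V} := HB.pack (fun v => phi (replace (rpart s x) i v)) D.
by apply: (@wedge_derivation L) => [z j v|]; [apply: tau_phi | apply: phi_der].
Qed.

End Wedge.

Theorem proposition6p5 (K : fieldType) (char0 : [pchar K] =i pred0)
    (V : lmodType K) (n p : nat) (n_gt0 : (0 < n)%N) (p_gt0 : (0 < p)%N)
    (phi : {ffun 'I_n -> V} -> V) (tau : {ffun 'I_p -> V} -> K^o)
    (phi_nambu : nambu_lie phi) (tau_form : is_form tau)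
    (tau_compat : compatible phi tau)
    (tau_wedge : forall (x : {ffun 'I_p.-1 -> V}) (y : {ffun 'I_(1 + p) -> V}),
        wedge (contraction x tau) tau y = 0) :
  nambu_lie (wedge tau phi).
Proof.
have [phi_lin _ _] := phi_nambu; have [tau_lin tau_skew] := tau_form.
split; [exact: multilinear_wedge | exact: skew_symmetric_wedge |].
apply: fundamental_identity_slot => [|z k]; first by rewrite addn_gt0 p_gt0.
by apply: wedge_slot_derivation => //; apply: nambu_lie_slot.
Qed.
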